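(* Let $n\ge 3$ and let $\mathcal{F}$ be a family of subsets of $[n]=\{1,\dots,n\}$. Assume that there are no 3 different sets $A,B,C\in\mathcal{F}$ such that either (a) $A\subset B$, $A\subset C$ and $|B|=|C|$, or (b) $B\subset A$, $C\subset A$ and $|B|=|C|$. Then $|\mathcal{F}|\le 2\binom{n-1}{\lfloor\frac{n-1}{2}\rfloor}$. *)

(* Defs.v *)
From mathcomp Require Import all_boot.

Set Implicit Arguments.
Unset Strict Implicit.
Unset Printing Implicit Defensive.

(* Main.v *)
(* For n = 2k and F containing neither the empty nor the full set, give every
   member of F mass 1 and push the mass of the sets of size at most k upwards,
   one level at a time, to the sets of size k: no mass is lost and no set ever
   holds more than 1. Push the mass from above downwards in the same way. A set
   of size k in F keeps 1 from each side, hence 2 in all for a member counted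
   twice. A set M of size k outside F that receives mass from both sides lies
   between two members of F; then F has at most one member of each size on each
   side of M, and M receives at most 1/2 from each side. So |F| <= 'C(2k, k).
   If F contains the empty or the full set, its members have distinct sizes.
   For n = 2k + 1, split F according to membership of a fixed point and use
   the even case twice. *)
Require Import Defs.
From mathcomp Require Import all_boot.
From mathcomp Require Import order ssralg ssrnum rat.
From mathcomp Require Import zify lra.

Set Implicit Arguments.
Unset Strict Implicit.
Unset Printing Implicit Defensive.

Import Order.TTheory GRing.Theory Num.Theory.

(** * The two exclusion conditions, exchanged by complementation *)

Definition up_unique (T : finType) (F : {set {set T}}) :=
  forall A B C, A \in F -> B \in F -> C \in F ->
  A \subset B -> A \subset C -> #|B| = #|C| -> B = C.

Definition down_unique (T : finType) (F : {set {set T}}) :=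
  forall A B C, A \in F -> B \in F -> C \in F ->
  B \subset A -> C \subset A -> #|B| = #|C| -> B = C.

Definition compl_family (T : finType) (F : {set {set T}}) :=
  [set A | ~: A \in F].

Section Families.
Variable T : finType.
Implicit Types (F : {set {set T}}) (A B C X Y M : {set T}).

Lemma up_unique_compl F : down_unique F -> up_unique (compl_family F).
Proof.
move=> dF A B C; rewrite !inE => FA FB FC sAB sAC eqBC.
apply: setC_inj; apply: (dF (~: A)); rewrite ?setCS //.
by have := cardsC B; have := cardsC C; lia.
Qed.

Lemma down_unique_compl F : up_unique F -> down_unique (compl_family F).
Proof.
move=> uF A B C; rewrite !inE => FA FB FC sBA sCA eqBC.
apply: setC_inj; apply: (uF (~: A)); rewrite ?setCS //.
by have := cardsC B; have := cardsC C; lia.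
Qed.

Lemma card_compl_family F (P : pred nat) :
  #|[set A in compl_family F | P #|A|]| = #|[set A in F | P (#|T| - #|A|)]|.
Proof.
rewrite -(card_imset _ (@setC_inj T)); apply: eq_card => A.
rewrite !inE; apply/imsetP/andP => [[B + ->]|[FA PA]].
  rewrite !inE => /andP[FB PB]; split=> //.
  by rewrite (_ : #|T| - _ = #|B|) //; have := cardsC B; lia.
exists (~: A); rewrite ?setCK // !inE setCK FA /=.
by rewrite (_ : #|~: A| = #|T| - #|A|) //; have := cardsC A; lia.
Qed.

(** * Families containing the empty or the full set *)

Lemma card_with_setT F :
  down_unique F -> setT \in F -> #|F| <= #|T| + (set0 \in F).
Proof.
move=> dF FT; rewrite (cardsD1 set0) addnC leq_add2r.
have sz A : A \in F :\ set0 -> 0 < #|A| <= #|T|.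
  by rewrite max_card andbT !inE -card_gt0 => /andP[].
case: #|T| sz => [|m] sz.
  by rewrite leqn0 cards_eq0 -subset0; apply/subsetP => A /sz; lia.
(* All members lie below [setT], so their sizes differ. Nonempty sizes run from 1 to [m.+1]; the
   predecessor puts them into ['I_m.+1], where [inord] does not truncate. *)
rewrite -[X in _ <= X]card_ord -(@card_in_imset _ _ (fun A => inord #|A|.-1 : 'I_m.+1)).
  exact: max_card.
move=> A B FA FB /(congr1 val); move: (sz A FA) (sz B FB) => /andP[A0 lA] /andP[B0 lB].
rewrite /= !inordK; try lia; move=> eqAB.
move: FA FB; rewrite !inE => /andP[_ FA] /andP[_ FB].
by apply: (dF setT); rewrite ?subsetT //; lia.
Qed.

Lemma card_with_set0 F :
  up_unique F -> set0 \in F -> #|F| <= #|T| + (setT \in F).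
Proof.
move=> uF F0; have := card_compl_family F predT.
have E (G : {set {set T}}) : [set A in G | predT #|A|] = G by apply/setP => A; rewrite inE andbT.
rewrite !E => <-.
have := card_with_setT (down_unique_compl uF).
by rewrite !inE setCT setC0; apply.
Qed.

(** * Pushing mass upwards, level by level *)

Local Open Scope ring_scope.

(** Double counting of the pairs [x \in X]: for fixed [x], removing [x] is a bijection from the sets
    with [x] to the sets without it. *)
Lemma sum_setD1 (V : nmodType) (f : {set T} -> V) (P : pred {set T}) i :
  \sum_(X : {set T} | (#|X| == i.+1) && P X) \sum_(x in X) f (X :\ x)
  = \sum_(Y : {set T} | #|Y| == i) f Y *+ #|[set x | (x \notin Y) && P (x |: Y)]|.
Proof.
rewrite (exchange_big_dep predT) //=.
under [RHS]eq_bigr => Y _ do rewrite -sumr_const.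
rewrite [RHS](exchange_big_dep predT) //=; apply: eq_bigr => x _.
rewrite (reindex_onto (fun Y => x |: Y) (fun X => X :\ x)) /=; last first.
  by move=> X /andP[_ xX]; rewrite setD1K.
apply: eq_big => [Y|Y /andP[_ /eqP->]] //.
rewrite !inE eqxx /= andbT cardsU1.
case xY: (x \in Y) => /=; last first.
  by rewrite setU1K ?xY // eqxx andbT add1n eqSS.
rewrite andbF; apply/negbTE/negP => /andP[_ /eqP/setP/(_ x)].
by rewrite !inE eqxx xY.
Qed.

(* Each member of F carries mass 1, and the mass of a set Y is shared among the
   sets x |: Y outside F. If Y has positive mass, it contains a member of F, so
   at most one x |: Y is in F and giving each share 1 / (#|T| - #|Y| - 1) loses
   nothing. The index i is meant to be #|X|. *)
Fixpoint weight F i X : rat :=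
  if X \in F then 1 else
  if i is j.+1 then (\sum_(x in X) weight F j (X :\ x)) / (#|T| - i)%:R else 0.

Arguments weight : simpl never.

Lemma weight_mem F i X : X \in F -> weight F i X = 1.
Proof. by case: i => [|i]; rewrite /weight => ->. Qed.

Lemma weight_notin F i X : X \notin F ->
  weight F i.+1 X = (\sum_(x in X) weight F i (X :\ x)) / (#|T| - i.+1)%:R.
Proof. by rewrite /weight => /negbTE ->. Qed.

Lemma weight0 F X : weight F 0 X = (X \in F)%:R.
Proof. by rewrite /weight; case: ifP. Qed.

Lemma weight_ge0 F i X : 0 <= weight F i X.
Proof.
elim: i X => [|i IH] X; first by rewrite weight0 ler0n.
have [/weight_mem->//|nF] := boolP (X \in F).
by rewrite weight_notin // divr_ge0 ?ler0n ?sumr_ge0.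
Qed.

(** A set of size [i] outside [F] collects [i] terms of at most 1 and divides by [#|T| - i], which
    is at least [i] up to the middle level. *)
Lemma weight_le1 F i X : (i.*2 <= #|T|)%N -> #|X| = i -> weight F i X <= 1.
Proof.
elim: i X => [|i IH] X; first by rewrite weight0 lern1 leq_b1.
move=> le2 cX; have [/weight_mem ->//|nF] := boolP (X \in F).
rewrite weight_notin // ler_pdivrMr ?ltr0n; last lia.
rewrite mul1r; apply: (@le_trans _ _ (\sum_(x in X) 1)).
  apply: ler_sum => x xX; apply: IH; first lia.
  by have := cardsD1 x X; rewrite xX; lia.
by rewrite sumr_const cX ler_nat; lia.
Qed.

Lemma weight_support F i X : weight F i X != 0 ->
  exists2 A, A \in F & A \subset X.
Proof.
elim: i X => [|i IH] X; have [FX|nF] := boolP (X \in F); try by exists X.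
  by rewrite weight0 (negbTE nF).
rewrite weight_notin //.
have [/exists_inP[x xX wx] _|none] :=
  boolP [exists x in X, weight F i (X :\ x) != 0].
  have [A FA sA] := IH _ wx; exists A => //.
  exact: subset_trans sA (subD1set _ _).
rewrite big1 ?mul0r ?eqxx // => x xX.
by apply/eqP; apply: contraNT none => wx; apply/exists_inP; exists x.
Qed.

Lemma sum_weight_step F i : up_unique F -> (i.+1 < #|T|)%N ->
  \sum_(Y : {set T} | #|Y| == i) weight F i Y + #|[set A in F | #|A| == i.+1]|%:R
  <= \sum_(X : {set T} | #|X| == i.+1) weight F i.+1 X.
Proof.
move=> uF lti; rewrite [X in _ <= X](bigID (mem F)) /= addrC.
rewrite lerD //; last first.
  rewrite (eq_bigr (fun=> 1)); last by move=> X /andP[_ FX]; exact: weight_mem.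
  rewrite sumr_const ler_nat.
  by apply: subset_leq_card; apply/subsetP => X; rewrite !inE andbC.
under [X in _ <= X]eq_bigr => X /andP[_ nF] do rewrite weight_notin //.
rewrite -mulr_suml (sum_setD1 (weight F i) (fun X => X \notin F)).
rewrite ler_pdivlMr ?ltr0n; last lia.
rewrite mulr_suml; apply: ler_sum => Y /eqP cY.
have [->|wY] := eqVneq (weight F i Y) 0; first by rewrite mul0r mul0rn.
have [A FA sAY] := weight_support wY.
rewrite -[X in _ <= X]mulr_natr ler_wpM2l ?weight_ge0 // ler_nat.
have le1 : (#|[set x | (x \notin Y) && (x |: Y \in F)]| <= 1)%N.
  apply/card_le1P => x; rewrite inE => /andP[xY Fx] y; rewrite !inE.
  apply/andP/eqP => [[yY Fy]|->//].
  have /setP/(_ y) : x |: Y = y |: Y.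
    apply: (uF A) => //; rewrite ?(subset_trans sAY) ?subsetU1 //.
    by rewrite !cardsU1 xY yY.
  by rewrite !inE eqxx (negbTE yY) orbF => /eqP.
have : (#|~: Y| <= #|[set x | (x \notin Y) && (x |: Y \notin F)]|
         + #|[set x | (x \notin Y) && (x |: Y \in F)]|)%N.
  apply: leq_trans (leq_card_setU _ _); apply/subset_leq_card/subsetP => x.
  by rewrite !inE => ->; case: (_ \in F).
by have := cardsC Y; lia.
Qed.

Lemma sum_weight_ge F i : up_unique F -> (i < #|T|)%N ->
  #|[set A in F | (#|A| <= i)%N]|%:R
  <= \sum_(X : {set T} | #|X| == i) weight F i X.
Proof.
move=> uF; elim: i => [|i IH] lti.
  under [X in _ <= X]eq_bigr => X _ do rewrite weight0.
  rewrite -natr_sum ler_nat -big_mkcondr sum1_card.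
  by apply/subset_leq_card/subsetP => X; rewrite !inE leqn0 andbC.
apply: le_trans (sum_weight_step uF lti).
apply: (@le_trans _ _ (#|[set A in F | (#|A| <= i)%N]|%:R
   + #|[set A in F | #|A| == i.+1]|%:R)); last by rewrite lerD2r IH // ltnW.
rewrite -natrD ler_nat; apply: leq_trans (leq_card_setU _ _).
apply/subset_leq_card/subsetP => X.
by rewrite !inE leq_eqVlt ltnS => /andP[-> /=]; rewrite orbC.
Qed.

(** * Mass reaching a middle set between two members *)

(** A set [Y] of size [i] inside [M] extends by one point within [M] in [#|M| - i] ways, so only
    that many of its shares stay below [M]. *)
Lemma sum_weight_sub F i M :
  (i.+1 < #|T|)%N ->
  \sum_(X : {set T} | (#|X| == i.+1) && (X \subset M)) weight F i.+1 X
  <= #|[set X in F | (X \subset M) && (#|X| == i.+1)]|%:R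
     + (\sum_(Y : {set T} | (#|Y| == i) && (Y \subset M)) weight F i Y)
       * (#|M| - i)%:R / (#|T| - i.+1)%:R.
Proof.
move=> lti.
apply: (@le_trans _ _ (\sum_(X : {set T} | (#|X| == i.+1) && (X \subset M))
  ((X \in F)%:R + (\sum_(x in X) weight F i (X :\ x)) / (#|T| - i.+1)%:R))).
  apply: ler_sum => X _; have [FX|nF] := boolP (X \in F).
    by rewrite weight_mem // ler_wpDr // divr_ge0 ?ler0n ?sumr_ge0 // => x _;
       rewrite weight_ge0.
  by rewrite weight_notin // add0r.
rewrite big_split /= lerD //.
  rewrite -natr_sum ler_nat -big_mkcondr sum1_card.
  by apply/subset_leq_card/subsetP => X; rewrite !inE => /andP[/andP[-> ->] ->].
rewrite -mulr_suml ler_wpM2r ?invr_ge0 ?ler0n //.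
rewrite (sum_setD1 (weight F i) (fun X => X \subset M)) big_mkcondr mulr_suml.
apply: ler_sum => Y /eqP cY; rewrite -[X in X <= _]mulr_natr.
case: ifPn => [sYM|nsYM]; last first.
  rewrite (_ : [set x | _] = set0) ?cards0 ?mulr0 ?mul0r //.
  apply/setP => x; rewrite !inE; apply/negP => /andP[_ sM].
  by case/negP: nsYM; apply: subset_trans sM; rewrite subsetU1.
rewrite ler_wpM2l ?weight_ge0 // ler_nat -cY -cardsDS //.
apply/subset_leq_card/subsetP => x; rewrite !inE => /andP[-> /=].
by rewrite subUset sub1set => /andP[].
Qed.

(** All members below [M] lie below [C], so each level adds at most 1 to the mass [W i] below [M].
    This gives a recurrence for [W]; the last step divides by [k], so [W (k - 1) <= k / 2] is what
    is needed. *)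
Lemma weight_le_half F k M C :
  #|T| = k.*2 -> (0 < k)%N -> down_unique F -> set0 \notin F ->
  C \in F -> M \subset C -> M \notin F -> #|M| = k -> weight F k M <= 1 / 2.
Proof.
move=> cT k0 dF F0 FC sMC nFM cM.
pose W i := \sum_(X : {set T} | (#|X| == i) && (X \subset M)) weight F i X.
have W0 : W 0%N = 0.
  apply: big1 => X /andP[/eqP/cards0_eq-> _].
  by rewrite weight0 (negbTE F0).
(* On level [k] the only subset of [M] is [M] itself, which is not in [F], so no new mass enters
   there. *)
have WS i : (i < k)%N ->
    W i.+1 <= (i.+1 != k)%:R + W i * (k - i)%:R / (k.*2 - i.+1)%:R.
  move=> ltik; rewrite -{2}cM -cT; apply: le_trans (sum_weight_sub _ _ _) _.
    by lia.
  rewrite lerD2r ler_nat; have [eqik|neik] := eqVneq i.+1 k => /=.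
    rewrite leqn0 cards_eq0; apply/eqP/setP => X; rewrite !inE.
    apply/negP => /and3P[FX sXM /eqP cX]; case/negP: nFM.
    by have /eqP <- : X == M by rewrite eqEcard sXM cM cX eqik leqnn.
  apply/card_le1P => X; rewrite inE => /and3P[FX sXM /eqP cX] Y; rewrite !inE.
  apply/and3P/eqP => [[FY sYM /eqP cY]|->]; last by rewrite cX eqxx.
  by apply: (dF C) => //; rewrite ?(subset_trans _ sMC) // cX cY.
have Wle i : (0 < i < k)%N -> W i <= i.+1%:R / 2.
  elim: i => // i IH /andP[_ ltik].
  apply: le_trans (WS _ (ltnW ltik)) _; rewrite neq_ltn ltik /=.
  have [->|i0] := eqVneq i 0%N; first by rewrite W0 !mul0r; lra.
  (* This is equivalent to [1 <= i]; level 0 is harmless because [W 0 = 0]. *)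
  have ratio : (k - i)%:R / (k.*2 - i.+1)%:R <= 1 / 2 :> rat.
    rewrite ler_pdivrMr ?ltr0n; last lia.
    rewrite mulrAC mul1r ler_pdivlMr // -!natrM ler_nat; lia.
  have := IH ltac:(lia).
  have W_ge0 : 0 <= W i by apply: sumr_ge0 => X _; exact: weight_ge0.
  have := ler_wpM2l W_ge0 ratio; rewrite mulrA.
  have : 1 <= i%:R :> rat by rewrite ler1n lt0n.
  by rewrite -(natr1 i.+1) -(natr1 i); lra.
have WM : W k = weight F k M.
  rewrite /W (big_pred1 M) // => X /=; apply/andP/eqP => [[/eqP cX sXM]|->].
    by apply/eqP; rewrite eqEcard sXM cM cX leqnn.
  by rewrite cM eqxx.
case: k k0 {cT cM} WS Wle WM => // k _ WS Wle <-.
apply: le_trans (WS k (ltnSn k)) _; rewrite eqxx add0r subSnn mulr1.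
rewrite -addnn addSn addnS subSS -addnS addKn.
rewrite ler_pdivrMr ?ltr0n //.
have [->|k0] := eqVneq k 0%N; first by rewrite W0; lra.
by have := Wle k ltac:(lia); lra.
Qed.

Lemma weight_pair_le1 F k M :
  #|T| = k.*2 -> (0 < k)%N -> up_unique F -> down_unique F ->
  set0 \notin F -> setT \notin F -> #|M| = k ->
  weight F k M + weight (compl_family F) k (~: M) <= 1 + (M \in F)%:R.
Proof.
move=> cT k0 uF dF F0 FT cM.
have cMC : #|~: M| = k by have := cardsC M; lia.
have kT : (k.*2 <= #|T|)%N by rewrite cT.
have w1 := weight_le1 F kT cM; have w1' := weight_le1 (compl_family F) kT cMC.
have [FM|nFM] := boolP (M \in F); first by rewrite lerD.
rewrite addr0.
have [->|/weight_support[A FA sAM]] := eqVneq (weight F k M) 0.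
  by rewrite add0r.
have [->|/weight_support[B FB sBM]] :=
  eqVneq (weight (compl_family F) k (~: M)) 0; first by rewrite addr0.
have FB' : ~: B \in F by rewrite inE in FB.
have wh : weight F k M <= 1 / 2.
  by apply: (weight_le_half (C := ~: B)) => //; rewrite -setCS setCK.
have wh' : weight (compl_family F) k (~: M) <= 1 / 2.
  (* In the complement family the roles swap: [A] below [M] becomes the member [~: A] above
     [~: M]. *)
  apply: (weight_le_half (C := ~: A)); rewrite ?inE ?setCK ?setC0 ?setCS //.
  exact: down_unique_compl.
by lra.
Qed.

(** * The middle binomial bound on an even ground set *)

Lemma card_le_middle F k :
  #|T| = k.*2 -> (0 < k)%N -> up_unique F -> down_unique F ->
  set0 \notin F -> setT \notin F -> (#|F| <= 'C(k.*2, k))%N.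
Proof.
move=> cT k0 uF dF F0 FT.
have ltkT : (k < #|T|)%N by lia.
have low := sum_weight_ge uF ltkT.
have := sum_weight_ge (up_unique_compl dF) ltkT.
(* Complementing the index lets both masses be summed over the same sets of size [k]. *)
rewrite (reindex_inj (@setC_inj T)) /=.
rewrite (eq_bigl (fun M : {set T} => #|M| == k)); last first.
  by move=> M; have := cardsC M; lia.
move=> /(lerD low); rewrite -big_split /= => mass.
have {mass} : #|[set A in F | (#|A| <= k)%N]|%:R
    + #|[set A in compl_family F | (#|A| <= k)%N]|%:R
    <= \sum_(M : {set T} | #|M| == k) (1 + (M \in F)%:R) :> rat.
  apply: le_trans mass _; apply: ler_sum => M /eqP cM.
  exact: weight_pair_le1.
rewrite (card_compl_family F (fun i => i <= k)%N) big_split /=.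
rewrite sumr_const -natr_sum -!natrD ler_nat -cT.
rewrite -big_mkcondr sum1_card -cardsUI => count.
(* [U] covers [F], and [I] contains its members of size [k], counted from both sides; they cancel
   the extra 1 each such member is allowed. *)
set U := _ :|: _ in count; set I := _ :&: _ in count.
have FU : F \subset U.
  apply/subsetP => A FA; rewrite !inE FA /=.
  by case: leqP => //= ltkA; rewrite cT leq_subLR -addnn leq_add2r ltnW.
have FI : (#|[set A in F | #|A| == k]| <= #|I|)%N.
  apply/subset_leq_card/subsetP => A; rewrite !inE => /andP[-> /eqP->].
  by rewrite leqnn cT -addnn addnK leqnn.
rewrite -card_draws cardsE -(leq_add2r #|I|).
apply: leq_trans (leq_add (subset_leq_card FU) (leqnn _)) _.
apply: leq_trans count _; rewrite leq_add2l; apply: leq_trans FI.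
by apply/subset_leq_card/subsetP => A; rewrite !inE andbC.
Qed.

End Families.

(** * Binomial estimates and the even case *)

(** Absorbs families with distinct sizes, which have up to [k.*2 + 1] members; that extra 1 fails at
    [k = 1]. Pascal's rule and symmetry make the binomial more than double at each step. *)
Lemma leq_double_bin k : 0 < k -> k.*2 + (1 < k) <= 'C(k.*2, k).
Proof.
case: k => // k _; elim: k => // k IH.
have -> : 'C(k.+2.*2, k.+2) = 2 * ('C(k.+1.*2, k.+1) + 'C(k.+1.*2, k)).
  rewrite doubleS binS -bin_sub; last lia.
  rewrite (_ : _ - k.+2 = k.+1) ?addnn -?mul2n ?binS //; lia.
have : 0 < 'C(k.+1.*2, k) by rewrite bin_gt0; lia.
lia.
Qed.

(** Excluding just one of the two extreme sets is what each half of the odd case inherits. With both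
    present, a full chain on two points has 3 > 2 members. *)
Lemma card_le_even (T : finType) (F : {set {set T}}) k :
  #|T| = k.*2 -> 0 < k -> up_unique F -> down_unique F ->
  (set0 \notin F) || (setT \notin F) -> #|F| <= 'C(k.*2, k).
Proof.
move=> cT k0 uF dF F0T.
have le_bin : k.*2 <= 'C(k.*2, k) by have := leq_double_bin k0; lia.
case F0: (set0 \in F) in F0T; last first.
  case FT: (setT \in F); last by apply: card_le_middle; rewrite ?F0 ?FT.
  by apply: leq_trans (card_with_setT dF FT) _; rewrite F0 addn0 cT.
apply: leq_trans (card_with_set0 uF F0) _.
by rewrite (negbTE F0T) addn0 cT.
Qed.

Lemma double_bin_pred k : 0 < k -> 2 * 'C(k.*2.-1, k.-1) = 'C(k.*2, k).
Proof.
case: k => // k _; rewrite doubleS /= binS -[X in X + _]bin_sub; last lia.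
by rewrite (_ : _ - k.+1 = k) ?addnn ?mul2n //; lia.
Qed.

(** * Splitting a family at the point [ord0] *)

Section Split.
Variables (m : nat) (F : {set {set 'I_m.+1}}).
Let emb (B : {set 'I_m}) : {set 'I_m.+1} := lift ord0 @: B.

Let ord0_emb B : ord0 \notin emb B.
Proof. by apply/negP => /imsetP[x _] /eqP; rewrite (negbTE (neq_lift _ _)). Qed.

Let card_emb B : #|emb B| = #|B|.
Proof. exact/card_imset/lift_inj. Qed.

Let embS (A B : {set 'I_m}) : A \subset B -> emb A \subset emb B.
Proof. exact: imsetS. Qed.

Let emb_inj : injective emb.
Proof. exact/imset_inj/lift_inj. Qed.

Let emb_surj (A : {set 'I_m.+1}) : ord0 \notin A -> exists B, A = emb B.
Proof.
move=> A0; exists [set x : 'I_m | lift ord0 x \in A]; apply/setP => y.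
apply/idP/imsetP => [yA|[x + ->]]; last by rewrite inE.
case: (unliftP ord0 y) yA => [x ->|->] yA; last by rewrite yA in A0.
by exists x; rewrite ?inE.
Qed.

Definition family_without := [set B | emb B \in F].
Definition family_with := [set B | ord0 |: emb B \in F].

Lemma card_family_split : #|F| = #|family_without| + #|family_with|.
Proof.
rewrite -(cardsID [set A : {set 'I_m.+1} | ord0 \notin A] F).
congr (_ + _).
  rewrite -(card_imset _ emb_inj); apply: eq_card => A; rewrite !inE.
  apply/andP/imsetP => [[FA /emb_surj[B AB]]|[B + ->]].
    by exists B; rewrite // inE -AB.
  by rewrite inE => ->; rewrite ord0_emb.
have inj : injective (fun B => ord0 |: emb B).
  move=> B C eqBC; apply: emb_inj.
  by rewrite -(setU1K (ord0_emb B)) -(setU1K (ord0_emb C)) eqBC.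
rewrite -(card_imset _ inj); apply: eq_card => A; rewrite !inE negbK.
apply/andP/imsetP => [[A0 FA]|[B + ->]]; last first.
  by rewrite inE => ->; rewrite setU11.
have [B eqB] : exists B, A :\ ord0 = emb B.
  by apply: emb_surj; rewrite !inE eqxx.
by exists B; rewrite ?inE -eqB setD1K.
Qed.

Lemma up_unique_without : up_unique F -> up_unique family_without.
Proof.
move=> uF A B C; rewrite !inE => FA FB FC /embS sAB /embS sAC eqBC.
by apply: emb_inj; apply: (uF (emb A)); rewrite ?card_emb.
Qed.

Lemma down_unique_without : down_unique F -> down_unique family_without.
Proof.
move=> dF A B C; rewrite !inE => FA FB FC /embS sBA /embS sCA eqBC.
by apply: emb_inj; apply: (dF (emb A)); rewrite ?card_emb.
Qed.

Lemma up_unique_with : up_unique F -> up_unique family_with.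
Proof.
move=> uF A B C; rewrite !inE => FA FB FC /embS sAB /embS sAC eqBC.
apply: emb_inj; rewrite -(setU1K (ord0_emb B)) -(setU1K (ord0_emb C)).
congr (_ :\ _).
by apply: (uF (ord0 |: emb A)); rewrite ?setUS // !cardsU1 !ord0_emb !card_emb eqBC.
Qed.

Lemma down_unique_with : down_unique F -> down_unique family_with.
Proof.
move=> dF A B C; rewrite !inE => FA FB FC /embS sBA /embS sCA eqBC.
apply: emb_inj; rewrite -(setU1K (ord0_emb B)) -(setU1K (ord0_emb C)).
congr (_ :\ _).
by apply: (dF (ord0 |: emb A)); rewrite ?setUS // !cardsU1 !ord0_emb !card_emb eqBC.
Qed.

Lemma set0_family_without : (set0 \in family_without) = (set0 \in F).
Proof. by rewrite inE /emb imset0. Qed.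

Lemma setT_family_with : (setT \in family_with) = (setT \in F).
Proof.
rewrite inE (_ : _ |: _ = setT) //; apply/setP => x; rewrite !inE.
by case: (unliftP ord0 x) => [y ->|->]; rewrite ?eqxx // imset_f ?orbT.
Qed.

End Split.

(** * The bound, by parity of the ground set *)

Theorem theorem2p4 (n : nat) (hn : 3 <= n) (F : {set {set 'I_n}})
  (hF : ~ exists A B C : {set 'I_n},
      [/\ A \in F, B \in F & C \in F] /\
      [/\ A != B, A != C & B != C] /\
      ([/\ A \subset B, A \subset C & #|B| = #|C|] \/
       [/\ B \subset A, C \subset A & #|B| = #|C|])) :
  #|F| <= 2 * 'C(n - 1, (n - 1) %/ 2).
Proof.
have uF : up_unique F.
  move=> A B C FA FB FC sAB sAC eqBC; apply/eqP/negP => /negP neBC; apply: hF.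
  (* If [A = B], then [B] lies in [C] and has the same size, forcing [B = C]. *)
  have neAB : A != B.
    apply: contraNneq neBC => eqAB; rewrite -eqAB in eqBC *.
    by rewrite eqEcard sAC eqBC leqnn.
  have neAC : A != C.
    apply: contraNneq neBC => eqAC; rewrite -eqAC in eqBC *.
    by rewrite eq_sym eqEcard sAB eqBC leqnn.
  by exists A, B, C; split; [|split; [|left]].
have dF : down_unique F.
  move=> A B C FA FB FC sBA sCA eqBC; apply/eqP/negP => /negP neBC; apply: hF.
  have neAB : A != B.
    apply: contraNneq neBC => eqAB; rewrite -eqAB in eqBC *.
    by rewrite eq_sym eqEcard sCA eqBC leqnn.
  have neAC : A != C.
    apply: contraNneq neBC => eqAC; rewrite -eqAC in eqBC *.
    by rewrite eqEcard sBA eqBC leqnn.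
  by exists A, B, C; split; [|split; [|right]].
clear hF; rewrite subn1 divn2.
case: n hn F uF dF => // m hm F uF dF; rewrite [m.+1.-1]/=.
(* The members then have distinct sizes among [0, ..., m.+1]. *)
have bound : (set0 \in F) || (setT \in F) -> #|F| <= m.+2.
  case/orP=> [F0|FT].
    apply: leq_trans (card_with_set0 uF F0) _; rewrite card_ord.
    by case: (_ \in _); lia.
  apply: leq_trans (card_with_setT dF FT) _; rewrite card_ord.
  by case: (_ \in _); lia.
have [odd_m|even_m] := boolP (odd m).
  (* Here [3 <= n] gives [1 < k], so [leq_double_bin] covers all [k.*2 + 1] sizes. *)
  have [k [k1 mk]] : exists k, 1 < k /\ m.+1 = k.*2.
    by exists m.+1./2; have := odd_double_half m.+1; rewrite /= odd_m; lia.
  have -> : 'C(m, m./2) = 'C(k.*2.-1, k.-1) by congr 'C(_, _); lia.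
  rewrite double_bin_pred; last lia.
  have [F0T|] := boolP ((set0 \in F) || (setT \in F)).
    by have := bound F0T; have := leq_double_bin (ltnW k1); lia.
  rewrite negb_or => /andP[F0 FT].
  by apply: card_le_middle; rewrite ?card_ord //; lia.
have [k [k0 mk]] : exists k, 0 < k /\ m = k.*2.
  by exists m./2; have := odd_double_half m; rewrite (negbTE even_m); lia.
have cT : #|'I_m| = k.*2 by rewrite card_ord.
have -> : 'C(m, m./2) = 'C(k.*2, k) by rewrite mk doubleK.
have [F0T|] := boolP ((set0 \in F) || (setT \in F)).
  by have := bound F0T; have := leq_double_bin k0; lia.
rewrite negb_or => /andP[F0 FT].
(* The part without [ord0] still misses [set0], and the part with it still misses [setT]. *)
rewrite card_family_split mul2n -addnn leq_add //.
  apply: card_le_even => //; first exact: up_unique_without.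
    exact: down_unique_without.
  by rewrite set0_family_without F0.
apply: card_le_even => //; first exact: up_unique_with.
  exact: down_unique_with.
by rewrite setT_family_with FT orbT.
Qed.
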